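(* Let $\Sigma^n$ be a complete $n$-dimensional hypersurface immersed in $\mathbf R^{n+1}$ by $F$, with unit normal $\mathbf n$ and mean curvature $H$. (i) If some self-similar motion $F(p,t)=g(t)Q(t)F(p)+\mathbf v(t)$ of $\Sigma$ is the mean curvature flow of $\Sigma$ (up to tangential diffeomorphisms), then $$b\langle F,\mathbf n\rangle+\langle AF,\mathbf n\rangle+\langle \mathbf c,\mathbf n\rangle=-H \quad\text{on }\Sigma, \qquad ( * )$$ where $b=g'(0)\in\mathbf R$, $A=Q'(0)\in\mathfrak{so}(n+1)$ and $\mathbf c=\mathbf v'(0)\in\mathbf R^{n+1}$. (ii) Conversely, if $\Sigma$ satisfies $( * )$ for some $b\in\mathbf R$, $A\in\mathfrak{so}(n+1)$, $\mathbf c\in\mathbf R^{n+1}$, then $\Sigma$ moves in a self-similar manner under the mean curvature flow. More precisely, there is a vector $\mathbf w\in\mathbf R^{n+1}$ such that the translated hypersurface $\hat\Sigma$, given by $\hat F=F+\mathbf w$ (with unit normal $\hat{\mathbf n}=\mathbf n$ and mean curvature $\hat H=H$), satisfies the following. (a) If $b\neq 0$, then $b\langle \hat F,\hat{\mathbf n}\rangle+\langle A\hat F,\hat{\mathbf n}\rangle=-\hat H$, and $\hat F(p,t)=\sqrt{2bt+1}\,\exp\!\Big(\frac{\log(2bt+1)}{2b}A\Big)\hat F(p)$, defined for all $t$ with $2bt+1>0$, is the mean curvature flow of $\hat\Sigma$ (up to tangential diffeomorphisms). (b) If $b=0$, then there is $\mathbf c_0\in\mathbf R^{n+1}$ with $A\mathbf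 c_0=\mathbf 0$ such that $\langle A\hat F,\hat{\mathbf n}\rangle+\langle \mathbf c_0,\hat{\mathbf n}\rangle=-\hat H$, and $\hat F(p,t)=\exp(tA)\hat F(p)+t\mathbf c_0$, $t\in\mathbf R$, is the mean curvature flow of $\hat\Sigma$ (up to tangential diffeomorphisms).
   Context: The mean curvature vector of an immersed hypersurface is $\mathbf H=-H\mathbf n$, where $\mathbf n$ is a (local) choice of unit normal and $H=\operatorname{div}\mathbf n$ is the mean curvature. A self-similar motion of $\Sigma$ is a family $(\Sigma_t)_{t\in I}$ of immersed hypersurfaces with immersions $F(p,t)=g(t)Q(t)F(p)+\mathbf v(t)$, $p\in\Sigma$, $t\in I$, where $I$ is an interval containing $0$ and $g:I\to\mathbf R$, $Q:I\to SO(n+1)$, $\mathbf v:I\to\mathbf R^{n+1}$ are differentiable with $g(0)=1$, $Q(0)=\mathrm{Id}$, $\mathbf v(0)=\mathbf 0$. Such a family is the mean curvature flow of $\Sigma$ (up to tangential diffeomorphisms) if and only if $\left\langle\frac{\partial F}{\partial t}(p,t),\mathbf n(p,t)\right\rangle=-H(p,t)$ for all $p\in\Sigma$, $t\in I$, where $\mathbf n(p,t)$ and $H(p,t)$ are the unit normal and mean curvature of $\Sigma_t$. $\mathfrak{so}(n+1)$ is the space of real skew-symmetric $(n+1)\times(n+1)$ matrices. *)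

(* Defs.v *)
From HB Require Import structures.
From mathcomp Require Export all_boot all_order all_algebra.
From mathcomp Require Export all_classical all_reals all_analysis.
Export Order.TTheory GRing.Theory Num.Theory numFieldNormedType.Exports.

Set Implicit Arguments.
Unset Strict Implicit.
Unset Printing Implicit Defensive.

Local Open Scope classical_set_scope.
Local Open Scope ring_scope.

Section Calculus.
Context {R : realType}.

Definition dot {m : nat} (u v : 'cV[R]_m) : R := \sum_i u i 0 * v i 0.
Definition enorm {m : nat} (u : 'cV[R]_m) : R := Num.sqrt (dot u u).

(* Column j is the partial derivative in the direction of the j-th basis
   vector, so this is the transpose of the library's row-vector jacobian. *)
Definition Dmx {n m : nat} (f : 'cV[R]_n -> 'cV[R]_m) (x : 'cV[R]_n) :
    'M[R]_(m, n) :=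
  \matrix_(i, j) ('D_(delta_mx j 0) f x) i 0.

(* f is of class C^k at every point of V (meaningful for V open) *)
Fixpoint Ck {n m : nat} (k : nat) (V : set 'cV[R]_n)
    (f : 'cV[R]_n -> 'cV[R]_m) : Prop :=
  match k with
  | 0%N => forall x, V x -> {for x, continuous f}
  | k'.+1 => (forall x, V x -> differentiable f x) /\
             forall j : 'I_n, Ck k' V (fun x => 'D_(delta_mx j 0) f x)
  end.

Definition smooth_on {n m : nat} (V : set 'cV[R]_n)
    (f : 'cV[R]_n -> 'cV[R]_m) : Prop := forall k, Ck k V f.

(* Derivative of f relative to I: one-sided at an end point belonging to I. *)
Definition is_deriv_in {W : normedModType R} (I : set R) (f : R -> W) (t : R)
    (l : W) : Prop :=
  (s - t)^-1 *: (f s - f t) @[s --> within I t^'] --> l.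

Definition derivable_on {W : normedModType R} (I : set R) (f : R -> W) : Prop :=
  forall t, I t -> exists l, is_deriv_in I f t l.

Definition mexp {m : nat} (A : 'M[R]_m.+1) : 'M[R]_m.+1 :=
  limn (series (fun k => (k`!)%:R^-1 *: A ^+ k)).

Definition special_orthogonal {m : nat} (Q : 'M[R]_m) : Prop :=
  Q *m Q^T = 1%:M /\ \det Q = 1.

Definition skew_symmetric {m : nat} (A : 'M[R]_m) : Prop := A^T = - A.

End Calculus.

Record chart (R : realType) (n : nat) (M : topologicalType) := Chart {
  cdom : set M;
  ccod : set 'cV[R]_n;
  coord : M -> 'cV[R]_n;
  param : 'cV[R]_n -> M;
  _ : open cdom /\ open ccod;
  _ : (forall p, cdom p -> ccod (coord p)) /\
      (forall x, ccod x -> cdom (param x));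
  _ : (forall p, cdom p -> param (coord p) = p) /\
      (forall x, ccod x -> coord (param x) = x);
  _ : (forall p, cdom p -> {for p, continuous coord}) /\
      (forall x, ccod x -> {for x, continuous param}) }.

(* Smooth n-manifolds.  The smooth structure is the one generated by an atlas
   indexed by the points, chart_at p being a chart around p; any smooth
   manifold is obtained this way by choosing a chart around each point. *)
Record manifold (R : realType) (n : nat) := Manifold {
  mtop :> topologicalType;
  chart_at : mtop -> chart R n mtop;
  _ : hausdorff_space mtop;
  _ : @second_countable mtop;
  _ : forall p, cdom (chart_at p) p;
  _ : forall p q,
      smooth_on (ccod (chart_at p) `&` (param (chart_at p) @^-1` cdom (chart_at q)))
                (coord (chart_at q) \o param (chart_at p)) }.

Section Hypersurface.
Context {R : realType} {n : nat}.
Implicit Types (M : manifold R n).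

Definition loc {M m} (f : M -> 'cV[R]_m) (p : M) : 'cV[R]_n -> 'cV[R]_m :=
  f \o param (chart_at p).

Definition dloc {M m} (f : M -> 'cV[R]_m) (p : M) : 'M[R]_(m, n) :=
  Dmx (loc f p) (coord (chart_at p) p).

Definition smooth_map {M m} (U : set M) (f : M -> 'cV[R]_m) : Prop :=
  forall p, smooth_on (ccod (chart_at p) `&` (param (chart_at p) @^-1` U))
                      (loc f p).

Definition immersion {M} (F : M -> 'cV[R]_n.+1) : Prop :=
  smooth_map setT F /\ forall p, \rank (dloc F p) = n.

Definition unit_normal {M} (F : M -> 'cV[R]_n.+1) (U : set M)
    (N : M -> 'cV[R]_n.+1) : Prop :=
  [/\ open U, smooth_map U N &
      forall p, U p -> dot (N p) (N p) = 1 /\ (dloc F p)^T *m N p = 0].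

(* The divergence along the hypersurface F of a field N, in the chart at p:
   sum_ij g^ij <d_i N, d_j F> with g_ij = <d_i F, d_j F>. *)
Definition surface_div {M} (F N : M -> 'cV[R]_n.+1) (p : M) : R :=
  let DF := dloc F p in
  \tr (invmx (DF^T *m DF) *m ((dloc N p)^T *m DF)).

Definition mean_curvature {M} (F N : M -> 'cV[R]_n.+1) (p : M) : R :=
  surface_div F N p.

(* The equation  E(p, n) = - H(p)  on the whole hypersurface, n being any
   local choice of unit normal; every E below is odd in n, as H is. *)
Definition eq_neg_mean_curvature {M} (F : M -> 'cV[R]_n.+1)
    (E : M -> 'cV[R]_n.+1 -> R) : Prop :=
  forall U N, unit_normal F U N ->
  forall p, U p -> E p (N p) = - mean_curvature F N p.

Definition C1_curve {M} (gam : R -> M) : Prop :=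
  continuous gam /\
  forall t, let f := coord (chart_at (gam t)) \o gam in
    (\forall s \near t, derivable f s 1) /\ {for t, continuous (derive1 f)}.

(* Length for the metric induced by F. *)
Definition curve_length {M} (F : M -> 'cV[R]_n.+1) (gam : R -> M) : \bar R :=
  (\int[lebesgue_measure]_(t in `[0%R, 1%R]) (enorm (derive1 (F \o gam) t))%:E)%E.

(* Using C^1 curves gives the usual infimum: reparametrising with vanishing speed at the ends and at the corners, any
   piecewise C^1 path on [0, 1] becomes the restriction of a C^1 curve. *)
Definition induced_dist {M} (F : M -> 'cV[R]_n.+1) (p q : M) : \bar R :=
  ereal_inf [set curve_length F gam | gam in
    [set gam | [/\ C1_curve gam, gam 0 = p & gam 1 = q]]].

Definition complete_hypersurface {M} (F : M -> 'cV[R]_n.+1) : Prop :=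
  forall u : nat -> M,
    (forall e : R, 0 < e -> exists N : nat, forall i j : nat,
      (N <= i)%N -> (N <= j)%N -> (induced_dist F (u i) (u j) < e%:E)%E) ->
    exists l : M, forall e : R, 0 < e -> exists N : nat, forall i : nat,
      (N <= i)%N -> (induced_dist F (u i) l < e%:E)%E.

Definition self_similar_motion (I : set R) (g : R -> R)
    (Q : R -> 'M[R]_n.+1) (v : R -> 'cV[R]_n.+1) : Prop :=
  [/\ is_interval I /\ I 0,
      exists s, I s /\ s != 0,
      (forall t, I t -> special_orthogonal (Q t)),
      [/\ derivable_on I (g : R -> R^o), derivable_on I Q & derivable_on I v] &
      [/\ g 0 = 1, Q 0 = 1%:M & v 0 = 0]].

(* The flow is understood up to tangential diffeomorphisms: only the normal
   component of the velocity is prescribed. *)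
Definition mean_curvature_flow {M} (F : M -> 'cV[R]_n.+1) (I : set R)
    (Ft : R -> M -> 'cV[R]_n.+1) : Prop :=
  Ft 0 = F /\
  forall t, I t ->
    immersion (Ft t) /\
    exists V : M -> 'cV[R]_n.+1,
      (forall p, is_deriv_in I (fun s => Ft s p) t (V p)) /\
      eq_neg_mean_curvature (Ft t) (fun p nu => dot (V p) nu).

End Hypersurface.

(* Main.v *)
Require Import Defs.
From mathcomp Require Import ring lra.

(** The equation on the hypersurface is the flow equation at time 0: there the velocity of
    g Q F + v is b F + A F + c, and A is skew because Q(t) Q(t)^T = 1.

    For the converse, put B = b + A and let c = B w + c0 with c0 orthogonal to
    the range of B. Then c0 lies in the kernel of B^T = b - A, and since A is
    skew this forces b c0 = 0 and A c0 = 0 (skew_decomposition). The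
    velocity field B F + c becomes B (F + w) + c0 on the translated
    hypersurface, where c0 = 0 when b is not zero, and A c0 = 0 in any case.

    A similarity x |-> g Q x + v carries a unit normal N of F to Q N and
    divides the mean curvature by g (mean_curvature_similarity). Hence, if the
    equation holds for F with velocity field x |-> B x + c, the moving
    hypersurface g Q F + v solves the flow as soon as its velocity is the
    rotated field divided by g:
      (g Q)' = g^-1 Q B   and   v' = g^-1 Q c     (similarity_flow).
    With Q(t) = exp(theta(t) A) the first condition splits into g' = b / g and
    theta' = 1 / g^2, that is g^2 = 2 b t + 1 and theta = log(g^2) / (2 b), or
    g = 1 and theta = t when b = 0; the second condition is solved by
    v = g Q w - w + t c0 (soliton_flow). Applied to F this gives the
    motion of the given hypersurface; applied to F + w, with c0 in the place of
    c and no further translation, it gives the normalised motions.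

    Two facts on the matrix exponential are needed: the derivative of
    exp(s A), read off entrywise from power series, and the fact that exp(s A)
    is a rotation when A is skew, obtained by exhibiting matrix curves with
    zero derivative. *)

Set Implicit Arguments.
Unset Strict Implicit.
Unset Printing Implicit Defensive.

Local Open Scope classical_set_scope.
Local Open Scope ring_scope.

(** * Limits of matrices and relative derivatives *)

Section MatrixLimits.
Context {R : realType}.

Lemma cvg_mxP {T : Type} (F : set_system T) {FF : Filter F} m n
    (f : T -> 'M[R]_(m, n)) (l : 'M[R]_(m, n)) :
  f x @[x --> F] --> l <-> forall i j, f x i j @[x --> F] --> l i j.
Proof.
split=> [fl i j|fl].
  exact: (cvg_comp _ _ fl (@coord_continuous R m n i j l)).
move=> A [P lP PA]; rewrite nbhs_simpl /=.
have : \forall x \near F, forall i j, P i j (f x i j).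
  by apply: filter_forall => i; apply: filter_forall => j; exact: fl.
by apply: filterS => x; exact: PA.
Qed.

Lemma cvg_mulmx {T : Type} (F : set_system T) {FF : Filter F} m n p
    (f : T -> 'M[R]_(m, n)) (g : T -> 'M[R]_(n, p))
    (a : 'M[R]_(m, n)) (b : 'M[R]_(n, p)) :
  f x @[x --> F] --> a -> g x @[x --> F] --> b ->
  (f x *m g x) @[x --> F] --> a *m b.
Proof.
move=> /cvg_mxP fa /cvg_mxP gb; apply/cvg_mxP => i j; rewrite mxE.
under eq_fun do rewrite mxE.
apply: cvg_big => [|k _]; first exact: add_continuous.
by apply: cvgM; [exact: fa|exact: gb].
Qed.

Lemma mulmx_continuous m n p (B : 'M[R]_(m, n)) :
  continuous (mulmx B : 'M[R]_(n, p) -> 'M[R]_(m, p)).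
Proof.
move=> x; apply: (@cvg_mulmx _ (nbhs x) _ m n p (fun=> B) id B x).
  exact: cvg_cst.
exact: cvg_id.
Qed.

End MatrixLimits.

Section RelativeDerivative.
Context {R : realType}.
Implicit Types (I : set R) (t : R).

(** The filter omits the point t itself, so that this is the punctured form of
    continuity; it is what the product rules use. *)
Lemma is_deriv_in_continuous {W : normedModType R} I (f : R -> W) t l :
  is_deriv_in I f t l -> f s @[s --> within I t^'] --> f t.
Proof.
move=> fl; rewrite -[f t]add0r -[X in _ --> X + _](scale0r l).
apply: cvg_trans (_ : ((s - t) *: ((s - t)^-1 *: (f s - f t)) + f t)
    @[s --> within I t^'] --> _).
  apply: near_eq_cvg; near=> s.
  rewrite scalerA divff ?scale1r ?subrK// subr_eq0.
  by near: s; apply: filterS (nbhs_dnbhs_neq t).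
apply: cvgD; last exact: cvg_cst.
apply: cvgZ => //; rewrite -[X in _ --> X](subrr t).
apply: cvgB; last exact: cvg_cst.
by apply: cvg_trans (cvg_within _) _; exact: nbhs_dnbhs.
Unshelve. all: by end_near. Qed.

Lemma is_deriv_in_cst {W : normedModType R} I (c : W) t :
  is_deriv_in I (fun=> c) t 0.
Proof.
by rewrite /is_deriv_in subrr; under eq_fun do rewrite scaler0; exact: cvg_cst.
Qed.

Lemma is_deriv_inD {W : normedModType R} I (f g : R -> W) t df dg :
  is_deriv_in I f t df -> is_deriv_in I g t dg ->
  is_deriv_in I (fun s => f s + g s) t (df + dg).
Proof.
move=> fl gl; rewrite /is_deriv_in.
under eq_fun do rewrite opprD addrACA scalerDr.
exact: cvgD.
Qed.

Lemma is_deriv_inZ {W : normedModType R} I (k : R -> R) (f : R -> W) t dk df :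
  is_deriv_in I (k : R -> R^o) t dk -> is_deriv_in I f t df ->
  is_deriv_in I (fun s => k s *: f s) t (dk *: f t + k t *: df).
Proof.
move=> kl fl; rewrite /is_deriv_in.
have E s : (s - t)^-1 *: (k s *: f s - k t *: f t) =
    ((s - t)^-1 *: (k s - k t : R^o)) *: f s
    + k t *: ((s - t)^-1 *: (f s - f t)).
  rewrite -[_ *: (k s - k t : R^o)]/(_ * _) -scalerA.
  rewrite [k t *: (_ *: _)]scalerA [k t * _]mulrC -scalerA -scalerDr.
  congr (_ *: _).
  by rewrite scalerBl scalerBr addrA subrK.
under eq_fun do rewrite E.
apply: cvgD; apply: cvgZ => //; first exact: is_deriv_in_continuous fl.
exact: cvg_cst.
Qed.

Lemma is_deriv_in_mulmx I m n p (f : R -> 'M[R]_(m, n)) (g : R -> 'M[R]_(n, p))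
    t df dg :
  is_deriv_in I f t df -> is_deriv_in I g t dg ->
  is_deriv_in I (fun s => f s *m g s) t (df *m g t + f t *m dg).
Proof.
move=> fl gl; rewrite /is_deriv_in.
have E s : (s - t)^-1 *: (f s *m g s - f t *m g t) =
    ((s - t)^-1 *: (f s - f t)) *m g s + f t *m ((s - t)^-1 *: (g s - g t)).
  rewrite -scalemxAl -scalemxAr -scalerDr; congr (_ *: _).
  by rewrite mulmxBl mulmxBr addrA subrK.
under eq_fun do rewrite E.
apply: cvgD; apply: cvg_mulmx => //; first exact: is_deriv_in_continuous gl.
exact: cvg_cst.
Qed.

Lemma is_deriv_in_mxP I m n (f : R -> 'M[R]_(m, n)) t df :
  is_deriv_in I f t df <->
  forall i j, is_deriv_in I (fun s => f s i j : R^o) t (df i j).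
Proof.
have E i j : (fun s => ((s - t)^-1 *: (f s - f t)) i j) =
    fun s => (s - t)^-1 *: (f s i j - f t i j : R^o).
  by apply/funext => s; rewrite !mxE.
split=> [/cvg_mxP fl i j|fl]; first by rewrite /is_deriv_in -E; exact: fl.
by apply/cvg_mxP => i j; rewrite E; exact: fl.
Qed.

Lemma is_deriv_in_trmx I m n (f : R -> 'M[R]_(m, n)) t df :
  is_deriv_in I f t df -> is_deriv_in I (fun s => (f s)^T) t df^T.
Proof.
move=> /is_deriv_in_mxP fl; apply/is_deriv_in_mxP => i j; rewrite mxE.
under eq_fun do rewrite mxE.
exact: fl.
Qed.

Lemma is_deriv_inT (f : R -> R) t l :
  is_deriv_in setT (f : R -> R^o) t l <-> is_derive t 1 f l.
Proof.
rewrite /is_deriv_in withinET.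
have -> : ((s - t)^-1 *: (f s - f t : R^o)) @[s --> t^'] =
  (h^-1 *: ((f \o shift t) (h *: 1) - f t)) @[h --> 0^'].
  have S (P : set R) :
      (\forall s \near t, P s) = (\forall h \near 0, P (h + t)).
    by rewrite (near_shift 0) subr0.
  have E h : (h + t - t)^-1 *: (f (h + t) - f t : R^o) =
             h^-1 *: ((f \o shift t) (h *: 1) - f t).
    by rewrite addrK /= [h *: 1]mulr1.
  apply/funext => A.
  transitivity
    (\forall s \near t, s != t -> A ((s - t)^-1 *: (f s - f t))) => //.
  rewrite S; apply: eq_near => h.
  by rewrite E -subr_eq0 addrK.
split=> [fl|[/cvg_ex [l' fl'] <-]].
  by split; [apply/cvg_ex; exists l|exact: cvg_lim fl].
by rewrite /derive (cvg_lim _ fl').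
Qed.

Lemma is_derive_in I (f : R -> R) t l :
  is_derive t 1 f l -> is_deriv_in I (f : R -> R^o) t l.
Proof.
move=> /is_deriv_inT; rewrite /is_deriv_in withinET.
exact: cvg_within_filter.
Qed.

(** Matrix identities between curves are proved below by showing that a
    suitable product has zero derivative. *)
Lemma eq_cst_of_deriv0 m n (f : R -> 'M[R]_(m, n)) :
  (forall t, is_deriv_in setT f t 0) -> forall s t, f s = f t.
Proof.
move=> f0 s t; apply/matrixP => i j.
apply: (@is_derive_0_is_cst _ (fun s => f s i j)) => x.
by have /is_deriv_in_mxP/(_ i j)/is_deriv_inT := f0 x; rewrite mxE.
Qed.

(** An interval with two points accumulates at each of its points, so that
    relative derivatives are unique there. *)
Lemma within_interval_proper I t : is_interval I -> I t ->
  (exists s, I s /\ s != t) -> ProperFilter (within I t^').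
Proof.
move=> Ii It [s [Is st]]; apply: Build_ProperFilter_ex => A.
rewrite /within /= /dnbhs /within /= => /nbhs_ballP [e e0 eA].
(* The point t + d (s - t) lies between t and s, and d is small enough for it
   to be within e of t. *)
pose d := Num.min (e / 2 / `|s - t|) 1.
have st0 : 0 < `|s - t| by rewrite normr_gt0 subr_eq0.
have d0 : 0 < d by rewrite lt_min ltr01 !divr_gt0.
have d1 : d <= 1 by rewrite ge_min lexx orbT.
have de : d * `|s - t| < e.
  apply: (@le_lt_trans _ _ (e / 2)).
    by rewrite -ler_pdivlMr// ge_min lexx.
  by rewrite ltr_pdivrMr// ltr_pMr// ltr1n.
exists (t + d * (s - t)); apply: eA.
- by rewrite /ball /= opprD addNKr normrN normrM (gtr0_norm d0).
- rewrite -subr_eq0 addrAC subrr add0r.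
  by apply: mulf_neq0; [exact: lt0r_neq0|rewrite subr_eq0].
- have [ts|/ltW ts] := leP t s.
    have h1 : 0 <= d * (s - t) by rewrite mulr_ge0 ?subr_ge0// ltW.
    have h2 : d * (s - t) <= s - t by rewrite ler_piMl ?subr_ge0.
    by apply: (Ii t s) => //; apply/andP; split; lra.
  have h1 : 0 <= d * (t - s) by rewrite mulr_ge0 ?subr_ge0// ltW.
  have h2 : d * (t - s) <= t - s by rewrite ler_piMl ?subr_ge0.
  by apply: (Ii s t) => //; apply/andP; split; lra.
Qed.

Lemma is_deriv_in_unique {W : normedModType R} I (f : R -> W) t l l' :
  ProperFilter (within I t^') ->
  is_deriv_in I f t l -> is_deriv_in I f t l' -> l = l'.
Proof. by move=> PF; exact: (@cvg_unique W (@norm_hausdorff R W)). Qed.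

End RelativeDerivative.

(** * The matrix exponential *)

Section MatrixExponential.
Context {R : realType} {m : nat}.
Implicit Types A B : 'M[R]_m.+1.

(** Coefficient of x^k in the (i, j) entry of exp(x A) B. The extra factor B
    makes the family stable under termwise differentiation, which replaces
    B by A B. *)
Definition mexp_coef A B (i j : 'I_m.+1) (k : nat) : R :=
  (k`!)%:R^-1 * (A ^+ k *m B) i j.

Definition entry_sum A : R := \sum_i \sum_j `|A i j|.

Lemma row_sum_le A i : \sum_j `|A i j| <= entry_sum A.
Proof.
rewrite /entry_sum [leRHS](bigD1 i)//= lerDl sumr_ge0// => k _.
exact: sumr_ge0.
Qed.

Lemma normr_entry_le A i j : `|A i j| <= entry_sum A.
Proof.
apply: le_trans (row_sum_le A i).
by rewrite (bigD1 j)//= lerDl sumr_ge0.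
Qed.

(** The sum of the moduli of the entries is a submultiplicative bound; it gives
    the comparison with the scalar exponential series. *)
Lemma normr_exprM_entry_le A B k i j :
  `|(A ^+ k *m B) i j| <= entry_sum A ^+ k * entry_sum B.
Proof.
elim: k i => [|k IH] i; first by rewrite !expr0 mul1r mul1mx normr_entry_le.
rewrite exprS -mulmxA mxE (le_trans (ler_norm_sum _ _ _))//.
rewrite exprS -mulrA; apply: le_trans
  (_ : entry_sum A ^+ k * entry_sum B * \sum_l `|A i l| <= _).
  rewrite mulr_sumr ler_sum// => l _; rewrite normrM mulrC.
  by rewrite ler_wpM2r.
rewrite mulrC ler_wpM2r ?row_sum_le//.
exact: le_trans (normr_ge0 _) (IH i).
Qed.

Lemma cvg_mexp_coef A B i j x : cvgn (pseries (mexp_coef A B i j) x).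
Proof.
apply: normed_cvg.
have sum_ge0 C : 0 <= entry_sum C.
  by apply: sumr_ge0 => ? _; apply: sumr_ge0.
apply: (@series_le_cvg _ _
  (fun k => entry_sum B * exp_coeff (entry_sum A * `|x|) k)) => [k|k|k|].
- exact: normr_ge0.
- by rewrite mulr_ge0 ?exp_coeff_ge0 ?mulr_ge0.
- rewrite /mexp_coef /exp_coeff /= !normrM normfV normr_nat normrX exprMn.
  rewrite [leLHS](_ : _ =
      `|(A ^+ k *m B) i j| * (`|x| ^+ k / k`!%:R)); last first.
    by rewrite -mulrA mulrC -mulrA.
  rewrite [leRHS](_ : _ =
      entry_sum A ^+ k * entry_sum B * (`|x| ^+ k / k`!%:R)); last first.
    by rewrite -!mulrA mulrCA.
  by rewrite ler_wpM2r ?normr_exprM_entry_le// divr_ge0 ?exprn_ge0.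
- exact/is_cvg_seriesZ/is_cvg_series_exp_coeff.
Qed.

Lemma mexp_series_entry A x n i j :
  (series (fun k => (k`!)%:R^-1 *: (x *: A) ^+ k) n) i j =
  pseries (mexp_coef A 1%:M i j) x n.
Proof.
rewrite /pseries /series /= summxE; apply: eq_bigr => k _.
by rewrite /mexp_coef mulmx1 exprZn !mxE [x ^+ k * _]mulrC mulrA.
Qed.

Lemma cvg_mexp A x :
  series (fun k => (k`!)%:R^-1 *: (x *: A) ^+ k) n @[n --> \oo]
    --> mexp (x *: A).
Proof.
have h : series (fun k => (k`!)%:R^-1 *: (x *: A) ^+ k) n @[n --> \oo]
    --> \matrix_(i, j) limn (pseries (mexp_coef A 1%:M i j) x).
  apply/cvg_mxP => i j; rewrite mxE.
  under eq_fun do rewrite mexp_series_entry.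
  exact: cvg_mexp_coef.
have := h.
by move/cvg_lim; rewrite /mexp => ->.
Qed.

Lemma mexp_mulE A B x i j :
  (mexp (x *: A) *m B) i j = limn (pseries (mexp_coef A B i j) x).
Proof.
have : (series (fun k => (k`!)%:R^-1 *: (x *: A) ^+ k) n *m B) @[n --> \oo]
    --> mexp (x *: A) *m B.
  by apply: cvg_mulmx; [exact: cvg_mexp|exact: cvg_cst].
move=> /cvg_mxP/(_ i j) lim_ij.
have -> : pseries (mexp_coef A B i j) x =
    fun n => (series (fun k => (k`!)%:R^-1 *: (x *: A) ^+ k) n *m B) i j.
  apply/funext => n; rewrite mulmx_suml summxE /pseries /series /=.
  apply: eq_bigr => k _.
  by rewrite /mexp_coef exprZn -!scalemxAl !mxE mulrCA mulrA mulrC mulrA.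
exact/esym/(cvg_lim (@norm_hausdorff _ _) lim_ij).
Qed.

Lemma pseries_diffs_mexp A B i j :
  pseries_diffs (mexp_coef A B i j) = mexp_coef A (A *m B) i j.
Proof.
apply/funext => k; rewrite /pseries_diffs /mexp_coef.
rewrite factS natrM invfM mulrA mulrA divff ?pnatr_eq0// mul1r.
by rewrite exprSr -mulmxA.
Qed.

Lemma is_derive_mexp A (x : R) i j :
  is_derive x 1 (fun s : R => mexp (s *: A) i j) ((mexp (x *: A) *m A) i j).
Proof.
rewrite (_ : (fun s => _) = fun s => limn (pseries (mexp_coef A 1%:M i j) s)).
  rewrite mexp_mulE.
  rewrite (_ : mexp_coef A A i j = pseries_diffs (mexp_coef A 1%:M i j));
    last by rewrite pseries_diffs_mexp mulmx1.
  apply: (@pseries_snd_diffs _ _ (`|x| + 1)).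
  - exact: cvg_mexp_coef.
  - rewrite pseries_diffs_mexp; exact: cvg_mexp_coef.
  - rewrite !pseries_diffs_mexp; exact: cvg_mexp_coef.
  - by rewrite [ltRHS]ger0_norm ?addr_ge0// ltrDl.
by apply/funext => s; rewrite -mexp_mulE mulmx1.
Qed.

Lemma is_deriv_in_mexp (I : set R) A (h : R -> R) (t dh : R) :
  is_derive t 1 h dh ->
  is_deriv_in I (fun s => mexp (h s *: A)) t (dh *: (mexp (h t *: A) *m A)).
Proof.
move=> hd; apply/is_deriv_in_mxP => i j; apply: is_derive_in.
rewrite mxE mulrC.
exact: (is_derive1_comp (is_derive_mexp A (h t) i j) hd).
Qed.

Lemma mexp0 : mexp (0 : 'M[R]_m.+1) = 1%:M.
Proof.
rewrite /mexp; apply: (@cvg_lim _ (@norm_hausdorff _ _)).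
apply: cvg_near_cst; exists 1%N => // -[|n] //= _.
rewrite /series /= big_nat_recl//= expr0 fact0 invr1 scale1r big1 ?addr0//.
by move=> k _; rewrite expr0n /= scaler0.
Qed.

Lemma mexp_fix A (c : 'cV[R]_m.+1) t : A *m c = 0 -> mexp (t *: A) *m c = c.
Proof.
move=> Ac; rewrite -[RHS]mul1mx -mexp0 -(scale0r A).
apply: (eq_cst_of_deriv0 (f := fun s => mexp (s *: A) *m c)) => s.
have := is_deriv_in_mulmx (is_deriv_in_mexp setT (A := A) (is_derive_id s 1))
  (is_deriv_in_cst setT c s).
by rewrite scale1r mulmx0 addr0 -mulmxA Ac mulmx0.
Qed.

(** For fixed t the left-hand side does not depend on s: its derivative is
    exp((s + t) A) (A + A^T) exp(s A)^T = 0. With t = 0 this is orthogonality,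
    and with s = t it becomes the doubling formula exp(2 t A) = exp(t A)^2. *)
Lemma mexp_skewD A (s t : R) : skew_symmetric A ->
  mexp ((s + t) *: A) *m (mexp (s *: A))^T = mexp (t *: A).
Proof.
move=> skA; transitivity (mexp ((0 + t) *: A) *m (mexp (0 *: A))^T); last first.
  by rewrite add0r scale0r mexp0 trmx1 mulmx1.
apply: (eq_cst_of_deriv0
  (f := fun s => mexp ((s + t) *: A) *m (mexp (s *: A))^T)) => x.
have hd : is_derive x 1 (fun s => s + t) 1.
  by apply: is_derive_eq; rewrite addr0.
have := is_deriv_in_mulmx (is_deriv_in_mexp setT (A := A) hd)
  (is_deriv_in_trmx (is_deriv_in_mexp setT (A := A) (is_derive_id x 1))).
by rewrite !scale1r trmx_mul skA mulNmx mulmxN mulmxA subrr.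
Qed.

(** The determinant is 1 because exp(t A) is the square of the orthogonal
    matrix exp(t/2 A), whose determinant is 1 or -1. *)
Lemma mexp_special_orthogonal A t :
  skew_symmetric A -> special_orthogonal (mexp (t *: A)).
Proof.
move=> skA.
have orth s : mexp (s *: A) *m (mexp (s *: A))^T = 1%:M.
  by have := mexp_skewD (A := A) s 0 skA; rewrite addr0 scale0r mexp0.
split; first exact: orth.
pose Q := mexp ((t / 2) *: A).
have QTQ : Q^T *m Q = 1%:M by exact/mulmx1C/orth.
have -> : mexp (t *: A) = Q *m Q.
  have /(congr1 (mulmx^~ Q)) := mexp_skewD (t / 2) (t / 2) skA.
  by rewrite -splitr -mulmxA QTQ mulmx1.
rewrite det_mulmx -[X in _ * X]det_tr -det_mulmx orth; exact: det1.
Qed.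

End MatrixExponential.

(** * Linear algebra of skew-symmetric matrices *)

Section InnerProduct.
Context {R : realType} {m : nat}.
Implicit Types (u v : 'cV[R]_m) (a : R) (B : 'M[R]_m).

Lemma dotE u v : dot u v = (u^T *m v) 0 0.
Proof. by rewrite /dot mxE; apply: eq_bigr => i _; rewrite mxE. Qed.

Lemma dotC u v : dot u v = dot v u.
Proof. by rewrite /dot; apply: eq_bigr => i _; rewrite mulrC. Qed.

Lemma dotDl u u' v : dot (u + u') v = dot u v + dot u' v.
Proof. by rewrite !dotE linearD mulmxDl mxE. Qed.

Lemma dotZl a u v : dot (a *: u) v = a * dot u v.
Proof. by rewrite !dotE linearZ -scalemxAl mxE. Qed.

Lemma dot_mull B u v : dot (B *m u) v = dot u (B^T *m v).
Proof. by rewrite !dotE trmx_mul mulmxA. Qed.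

Lemma dot_eq0 u : (dot u u == 0) = (u == 0).
Proof.
apply/idP/eqP => [|->]; last by rewrite /dot big1// => i _; rewrite mxE mul0r.
rewrite /dot psumr_eq0 => [/allP u0|i _]; last by rewrite -expr2 sqr_ge0.
apply/matrixP => i j; rewrite ord1 mxE.
have /implyP/(_ isT) := u0 i (mem_index_enum i).
by rewrite mulf_eq0 orbb => /eqP.
Qed.

Lemma dot_skew B u : skew_symmetric B -> dot (B *m u) u = 0.
Proof.
move=> skB; have := dot_mull B u u.
by rewrite skB mulNmx [RHS]dotC -scaleN1r dotZl => h; lra.
Qed.

(** Pairing (a + B) u = 0 with u leaves a |u|^2 = 0, so that the two terms
    vanish separately. *)
Lemma ker_scalar_add_skew a B u : skew_symmetric B ->
  (a%:M + B) *m u = 0 -> a *: u = 0 /\ B *m u = 0.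
Proof.
move=> skB Bu0.
have au0 : a *: u = 0.
  have : dot ((a%:M + B) *m u) u = 0 by rewrite Bu0 dotE trmx0 mul0mx mxE.
  rewrite mulmxDl mul_scalar_mx dotDl dotZl dot_skew// addr0 => /eqP.
  by rewrite mulf_eq0 dot_eq0 => /orP[]/eqP->; rewrite ?scale0r ?scaler0.
by split=> //; move: Bu0; rewrite mulmxDl mul_scalar_mx au0 add0r.
Qed.

(** The space is the sum of the range of a + B and of the kernel of its
    transpose a - B, and the previous lemma describes that kernel. *)
Lemma skew_decomposition a B (c : 'cV[R]_m) : skew_symmetric B ->
  exists w c0, [/\ c = (a%:M + B) *m w + c0, a *: c0 = 0 & B *m c0 = 0].
Proof.
move=> skB; pose C := a%:M + B.
have kerCT (u : 'cV[R]_m) : C^T *m u = 0 -> a *: u = 0 /\ B *m u = 0.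
  rewrite /C linearD /= tr_scalar_mx skB => /ker_scalar_add_skew[|-> ].
    by rewrite /skew_symmetric linearN /= skB.
  by rewrite mulNmx => /eqP; rewrite oppr_eq0 => /eqP.
(* In row-vector form: the row space of C^T is the range of C, and its
   intersection with the left kernel of C, the kernel of C^T, is trivial. *)
have cap0 : (C^T :&: kermx C)%MS = 0.
  apply/eqP/rowV0P => x; rewrite sub_capmx => /andP[/submxP[y ->]].
  move=> /sub_kermxP/(congr1 trmx); rewrite !trmx_mul trmxK trmx0 => Cu0.
  apply/trmx_inj/eqP; rewrite trmx0 trmx_mul trmxK -dot_eq0 dot_mull Cu0.
  by rewrite dotE mulmx0 mxE.
have full : row_full (C^T + kermx C)%MS.
  rewrite -col_leq_rank -(leq_add2r (\rank (C^T :&: kermx C)%MS)).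
  by rewrite mxrank_sum_cap cap0 mxrank0 addn0 mxrank_tr mxrank_ker
    subnKC ?rank_leq_row.
have /sub_addsmxP[[y z] /= cE] : (c^T <= C^T + kermx C)%MS by exact: submx_full.
pose c0 := (z *m kermx C)^T.
have /kerCT[ac0 Bc0] : C^T *m c0 = 0.
  by rewrite -trmx_mul -mulmxA mulmx_ker mulmx0 trmx0.
by exists y^T, c0; split=> //; rewrite -[c]trmxK cE linearD /= trmx_mul trmxK.
Qed.

End InnerProduct.

Section Gram.
Context {R : realType}.

Lemma gram_unit m n (D : 'M[R]_(m, n)) : \rank D = n -> D^T *m D \in unitmx.
Proof.
move=> rD; rewrite -row_free_unit -kermx_eq0; apply/rowV0P => x /sub_kermxP.
move=> /(congr1 (mulmx^~ x^T)); rewrite mul0mx -!mulmxA.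
have -> : x *m (D^T *m (D *m x^T)) = (D *m x^T)^T *m (D *m x^T).
  by rewrite trmx_mul trmxK !mulmxA.
move=> h.
have /eqP : dot (D *m x^T) (D *m x^T) = 0 by rewrite dotE h mxE.
rewrite dot_eq0 => /eqP Dx0.
have /row_freeP[E DE] : row_free D^T by rewrite /row_free mxrank_tr rD.
by rewrite -[x]mulmx1 -DE mulmxA -[x *m _]trmxK trmx_mul trmxK Dx0 trmx0 mul0mx.
Qed.

End Gram.

(** * Regularity of affine images of maps *)

Section AffineImages.
Context {R : realType}.

Lemma differentiable_affine n m p (B : 'M[R]_(p, m)) (v : 'cV[R]_p)
    (f : 'cV[R]_n -> 'cV[R]_m) x :
  differentiable f x -> differentiable (fun y => B *m f y + v) x.
Proof.
move=> df; apply: differentiableD; last exact: differentiable_cst.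
apply: (@differentiable_comp _ _ _ _ f (mulmx B)) => //.
exact/linear_differentiable/mulmx_continuous.
Qed.

Lemma derive_affine n m p (B : 'M[R]_(p, m)) (v : 'cV[R]_p)
    (f : 'cV[R]_n -> 'cV[R]_m) x e :
  differentiable f x -> 'D_e (fun y => B *m f y + v) x = B *m 'D_e f x.
Proof.
move=> /(@diff_derivable _ _ _ f x e) /cvg_ex[l fl].
rewrite [in RHS]/derive (cvg_lim (@norm_hausdorff _ _) fl).
apply: (@cvg_lim _ (@norm_hausdorff _ _)).
have -> : (fun h => h^-1 *: (((fun y => B *m f y + v) \o shift x) (h *: e)
      - (B *m f x + v))) =
    fun h => B *m (h^-1 *: ((f \o shift x) (h *: e) - f x)).
  by apply/funext => h; rewrite /= opprD addrACA subrr addr0 -mulmxBr scalemxAr.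
by apply: cvg_mulmx fl; exact: cvg_cst.
Qed.

Lemma near0_differentiable (V W : normedModType R) (h : V -> W) x :
  (\near x, h x = 0) -> differentiable h x.
Proof.
move=> h0; have hx0 := nbhs_singleton h0.
have ho : h \o shift x = cst (h x) + (\0 : V -> W) +o_ 0 id.
  apply/eqaddoP => e e0.
  have : \forall y \near 0, h (y + x) = 0.
    by move: h0; rewrite (near_shift 0) subr0.
  apply: filterS => y hy.
  rewrite !fctE /= hy hx0 addr0 subr0 normr0 mulr_ge0 //; exact: ltW.
have dh : 'd h x = (\0 : V -> W) :> (V -> W).
  apply: (@diff_unique _ _ _ h (\0 : {linear V -> W}) x) => // ?.
  exact: cvg_cst.
by apply/diff_locallyP; rewrite dh; split=> // ?; exact: cvg_cst.
Qed.

Lemma near_eq_differentiable (V W : normedModType R) (f g : V -> W) x :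
  (\near x, f x = g x) -> differentiable f x -> differentiable g x.
Proof.
move=> fg df; rewrite (_ : g = f + (g - f)); last by rewrite addrC subrK.
apply: differentiableD => //; apply: near0_differentiable.
by apply: filterS fg => y fgy; rewrite !fctE fgy subrr.
Qed.

(** C^k regularity is defined through derivatives of the given function, which
    change with values outside V; openness of V makes it a property of the
    restriction to V. *)
Lemma eq_Ck n m k (V : set 'cV[R]_n) (f g : 'cV[R]_n -> 'cV[R]_m) :
  open V -> (forall x, V x -> f x = g x) -> Ck k V f -> Ck k V g.
Proof.
move=> oV; elim: k f g => [|k IH] f g fg /=.
  move=> Cf x Vx; rewrite /prop_for /continuous_at -(fg x Vx).
  apply: cvg_trans (Cf x Vx); apply: near_eq_cvg; first exact: nbhs_filter.
  have Vnear : nbhs x V by exact: open_nbhs_nbhs.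
  by apply: filterS Vnear => y /fg.
have near_fg x : V x -> \near x, f x = g x.
  move=> Vx; have Vnear : nbhs x V by exact: open_nbhs_nbhs.
  by apply: filterS Vnear => y /fg.
move=> [df Cf]; split=> [x Vx|j].
  exact: (near_eq_differentiable (near_fg x Vx) (df x Vx)).
apply: IH (Cf j) => x Vx.
exact: near_eq_derive (near_fg x Vx).
Qed.

(** The partial derivatives of B f + v agree with B times those of f only on
    V, whence the use of eq_Ck in the induction. *)
Lemma Ck_affine n m p k (V : set 'cV[R]_n) (B : 'M[R]_(p, m)) (v : 'cV[R]_p)
    (f : 'cV[R]_n -> 'cV[R]_m) :
  open V -> Ck k V f -> Ck k V (fun x => B *m f x + v).
Proof.
move=> oV; elim: k v f => [|k IH] v f /=.
  move=> Cf x Vx.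
  have BCf : (mulmx B \o f) y @[y --> x] --> B *m f x.
    exact: (continuous_comp (Cf x Vx) (@mulmx_continuous R p m 1 B (f x))).
  exact: (cvgD BCf (cvg_cst v)).
move=> [df Cf]; split=> [x Vx|j]; first exact/differentiable_affine/df.
apply: eq_Ck (IH 0 _ (Cf j)) => // x Vx.
by rewrite addr0 derive_affine//; exact: df.
Qed.

Lemma Dmx_affine n m p (B : 'M[R]_(p, m)) (v : 'cV[R]_p)
    (f : 'cV[R]_n -> 'cV[R]_m) x :
  differentiable f x -> Dmx (fun y => B *m f y + v) x = B *m Dmx f x.
Proof.
move=> df; apply/matrixP => i j; rewrite !mxE derive_affine// mxE.
by apply: eq_bigr => k _; rewrite mxE.
Qed.

End AffineImages.

(** * Hypersurfaces under affine maps and similarities *)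

Section AffineHypersurfaces.
Context {R : realType} {n : nat} {M : manifold R n}.

Lemma open_chart_preimage (p : M) U : open U ->
  open (ccod (chart_at p) `&` (param (chart_at p) @^-1` U)).
Proof.
case: (chart_at p) => cd cc co pa [ocd occ] _ _ [_ pc] /= oU.
rewrite openE => x [/= ccx Ux]; rewrite /interior; apply: filterI.
  exact: open_nbhs_nbhs.
by apply: (pc x ccx); exact: open_nbhs_nbhs.
Qed.

Lemma chart_preimage_coord (p : M) (U : set M) : U p ->
  (ccod (chart_at p) `&` (param (chart_at p) @^-1` U)) (coord (chart_at p) p).
Proof.
have : cdom (chart_at p) p by case: M p => T ch ? ? cdp.
case: (chart_at p) => cd cc co pa /= _ [cdcc _] [paco _] _ cdp Up.
by split; [exact: cdcc|rewrite /= paco].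
Qed.

Lemma smooth_map_differentiable m (U : set M) (f : M -> 'cV[R]_m) p :
  smooth_map U f -> U p -> differentiable (loc f p) (coord (chart_at p) p).
Proof.
by move=> sf Up; have [+ _] := sf p 1%N; apply; exact: chart_preimage_coord.
Qed.

Lemma smooth_map_affine m k (U : set M) (B : 'M[R]_(k, m)) v
    (f : M -> 'cV[R]_m) :
  open U -> smooth_map U f -> smooth_map U (fun p => B *m f p + v).
Proof.
move=> oU sf p l; apply: (Ck_affine B v _ (sf p l)).
exact: open_chart_preimage.
Qed.

Lemma dloc_affine m k (U : set M) (B : 'M[R]_(k, m)) v (f : M -> 'cV[R]_m) p :
  smooth_map U f -> U p -> dloc (fun q => B *m f q + v) p = B *m dloc f p.
Proof.
by move=> sf Up; apply: Dmx_affine; exact: smooth_map_differentiable Up.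
Qed.

Lemma immersion_affine (B : 'M[R]_n.+1) v (F : M -> 'cV[R]_n.+1) :
  B \in unitmx -> immersion F -> immersion (fun p => B *m F p + v).
Proof.
move=> Bu [sF rF]; split=> [|p]; first exact: (smooth_map_affine _ _ openT sF).
rewrite (dloc_affine _ _ sF)// (eqmxMfull _ (_ : row_full B)) ?row_full_unit//.
Qed.

(** ** Similarities act on normals and mean curvature *)

Section Similarity.
Variables (F : M -> 'cV[R]_n.+1) (g : R) (Q : 'M[R]_n.+1) (v : 'cV[R]_n.+1).
Hypotheses (immF : immersion F) (g0 : g != 0) (QQT : Q *m Q^T = 1%:M).

Let G p := (g *: Q) *m F p + v.

Lemma immersion_similarity : immersion G.
Proof.
apply: immersion_affine => //.
by rewrite unitmxZ ?unitfE//; case: (mulmx1_unit QQT).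
Qed.

Lemma dloc_similarity p : dloc G p = g *: (Q *m dloc F p).
Proof. by rewrite (dloc_affine _ _ immF.1)// scalemxAl. Qed.

Lemma dloc_rotate (U : set M) N p : smooth_map U N -> U p ->
  dloc (fun q => Q^T *m N q) p = Q^T *m dloc N p.
Proof.
move=> sN Up; rewrite -(dloc_affine _ 0 sN Up).
by congr (dloc _ p); apply/funext => q; rewrite addr0.
Qed.

Lemma unit_normal_similarity U N :
  unit_normal G U N -> unit_normal F U (fun p => Q^T *m N p).
Proof.
move=> [oU sN nN]; split=> // [|p Up].
  have := smooth_map_affine Q^T 0 oU sN.
  by congr (smooth_map U _); apply/funext => q; rewrite addr0.
have [N1] := nN p Up; rewrite dloc_similarity => DN0; split.
  by rewrite dot_mull trmxK mulmxA QQT mul1mx.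
move: DN0; rewrite linearZ /= -scalemxAl trmx_mul mulmxA => /eqP.
by rewrite scaler_eq0 (negPf g0) /= => /eqP.
Qed.

(** In a chart the Gram matrix of G is g^2 times that of F, while the matrix of
    the products of the derivatives of N and G is g times that of Q^T N
    and F. *)
Lemma mean_curvature_similarity U N p : unit_normal G U N -> U p ->
  mean_curvature G N p = g^-1 * mean_curvature F (fun q => Q^T *m N q) p.
Proof.
move=> [oU sN nN] Up; rewrite /mean_curvature /surface_div.
rewrite (dloc_rotate sN Up) dloc_similarity.
set D := dloc F p; set D' := dloc N p.
have -> : (g *: (Q *m D))^T *m (g *: (Q *m D)) = (g * g) *: (D^T *m D).
  rewrite [(_ *: _)^T]linearZ /= -scalemxAl -scalemxAr scalerA trmx_mul.
  by rewrite -mulmxA [Q^T *m _]mulmxA (mulmx1C QQT) mul1mx.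
rewrite invmxZ; last by rewrite unitmxZ ?unitfE ?mulf_neq0// gram_unit ?immF.2.
rewrite trmx_mul trmxK -scalemxAr mulmxA -!scalemxAl -scalemxAr scalerA.
by rewrite !linearZ /= -mulmxA invfM mulrVK ?unitfE.
Qed.

End Similarity.

Lemma normal_and_curvature_translate (F : M -> 'cV[R]_n.+1) w :
  immersion F -> forall U N,
  (unit_normal (fun p => F p + w) U N <-> unit_normal F U N) /\
  (forall p, mean_curvature (fun p => F p + w) N p = mean_curvature F N p).
Proof.
move=> [sF _] U N.
have dE p : dloc (fun p => F p + w) p = dloc F p.
  rewrite -[RHS]mul1mx -(dloc_affine _ w sF)//.
  by congr (dloc _ p); apply/funext => q; rewrite mul1mx.
split=> [|p]; last by rewrite /mean_curvature /surface_div dE.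
by split=> -[oU sN nN]; split=> // p Up; have := nN p Up; rewrite dE.
Qed.

(** The field x |-> B x + c has normal component -H on F; under the similarity
    at time t the field is rotated and divided by g, as H is, so that the
    resulting velocity has the required normal component on the moved
    hypersurface. *)
Lemma similarity_flow (F : M -> 'cV[R]_n.+1) (B : 'M[R]_n.+1) c
    (I : set R) (g : R -> R) (Q : R -> 'M[R]_n.+1) v :
  immersion F ->
  eq_neg_mean_curvature F (fun p nu => dot (B *m F p + c) nu) ->
  g 0 = 1 -> Q 0 = 1%:M -> v 0 = 0 ->
  (forall t, I t -> [/\ 0 < g t, Q t *m (Q t)^T = 1%:M,
    is_deriv_in I (fun s => g s *: Q s) t ((g t)^-1 *: (Q t *m B)) &
    is_deriv_in I v t ((g t)^-1 *: (Q t *m c))]) ->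
  mean_curvature_flow F I (fun t p => g t *: (Q t *m F p) + v t).
Proof.
move=> immF eqF g0 Q0 v0 hI; split.
  by apply/funext => p; rewrite g0 Q0 v0 scale1r mul1mx addr0.
move=> t /hI[gt0 QQT dgQ dv].
have gn0 : g t != 0 by rewrite gt_eqF.
have -> : (fun p => g t *: (Q t *m F p) + v t) =
          fun p => (g t *: Q t) *m F p + v t.
  by apply/funext => p; rewrite scalemxAl.
split; first exact: immersion_similarity.
exists (fun p => (g t)^-1 *: (Q t *m (B *m F p + c))); split=> [p|U N nN p Up].
  have := is_deriv_inD (is_deriv_in_mulmx dgQ (is_deriv_in_cst I (F p) t)) dv.
  rewrite mulmx0 addr0 -scalemxAl -scalerDr -mulmxA -mulmxDr.
  by under eq_fun do rewrite -scalemxAl.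
rewrite (mean_curvature_similarity immF gn0 QQT nN Up) dotZl dot_mull.
by rewrite (eqF _ _ (unit_normal_similarity immF gn0 QQT nN) p Up) mulrN.
Qed.

(** The hypothesis that c0 is fixed by g^-1 covers both cases: c0 = 0 when b is
    not zero, and g = 1 when b = 0. *)
Lemma soliton_flow (F : M -> 'cV[R]_n.+1) (b : R) (A : 'M[R]_n.+1) w c0
    (I : set R) (g theta : R -> R) :
  immersion F -> skew_symmetric A -> A *m c0 = 0 ->
  eq_neg_mean_curvature F (fun p nu =>
    b * dot (F p) nu + dot (A *m F p) nu + dot ((b%:M + A) *m w + c0) nu) ->
  is_interval I -> I 0 -> (exists s, I s /\ s != 0) ->
  g 0 = 1 -> theta 0 = 0 ->
  (forall t, I t -> [/\ 0 < g t, is_derive t 1 g (b / g t),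
    is_derive t 1 theta ((g t) ^- 2) & (g t)^-1 *: c0 = c0]) ->
  let Q t := mexp (theta t *: A) in
  let v t := g t *: (Q t *m w) - w + t *: c0 in
  self_similar_motion I g Q v /\
  mean_curvature_flow F I (fun t p => g t *: (Q t *m F p) + v t).
Proof.
move=> immF skA Ac0 eqF intI I0 Is g0 theta0 hI Q v.
have Q0 : Q 0 = 1%:M by rewrite /Q theta0 scale0r mexp0.
have v0 : v 0 = 0 by rewrite /v g0 Q0 mul1mx scale1r subrr scale0r addr0.
have dQ t : I t -> is_deriv_in I Q t (g t ^- 2 *: (Q t *m A)).
  by move=> /hI[_ _ dtheta _]; exact: is_deriv_in_mexp.
have dgQ t : I t ->
    is_deriv_in I (fun s => g s *: Q s) t ((g t)^-1 *: (Q t *m (b%:M + A))).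
  move=> It; have [gt0 dg _ _] := hI t It.
  have := is_deriv_inZ (is_derive_in I dg) (dQ t It).
  congr (is_deriv_in I _ t _).
  rewrite mulmxDr mul_mx_scalar scalerDr !scalerA; congr (_ *: _ + _ *: _).
    by rewrite mulrC.
  by rewrite expr2 invfM mulVKf// gt_eqF.
have dv t : I t ->
    is_deriv_in I v t ((g t)^-1 *: (Q t *m ((b%:M + A) *m w + c0))).
  move=> It; have [gt0 _ _ gc0] := hI t It.
  have := is_deriv_inD (is_deriv_inD
      (is_deriv_in_mulmx (dgQ t It) (is_deriv_in_cst I w t))
      (is_deriv_in_cst I (- w) t))
    (is_deriv_inZ (is_derive_in I (is_derive_id t 1)) (is_deriv_in_cst I c0 t)).
  rewrite mulmx0 scaler0 !addr0 scale1r.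
  have -> : (g t)^-1 *: (Q t *m (b%:M + A)) *m w + c0 =
      (g t)^-1 *: (Q t *m ((b%:M + A) *m w + c0)).
    have Qc0 : Q t *m c0 = c0 by exact: mexp_fix.
    by rewrite -scalemxAl -mulmxA -[in LHS]gc0 -[in LHS]Qc0 -scalerDr -mulmxDr.
  by under eq_fun do rewrite -scalemxAl.
have orthQ t : special_orthogonal (Q t) by exact: mexp_special_orthogonal.
split.
  split=> //; split=> t It.
  - by have [_ dg _ _] := hI t It; eexists; exact: is_derive_in dg.
  - by eexists; exact: dQ.
  - by eexists; exact: dv.
apply: (@similarity_flow F (b%:M + A) ((b%:M + A) *m w + c0)) => //; last first.
  move=> t It; have [gt0 _ _ _] := hI t It; have [QQT _] := orthQ t.
  by split; auto.
move=> U N nN p Up; rewrite -(eqF U N nN p Up).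
by rewrite mulmxDl mul_scalar_mx !dotDl dotZl.
Qed.

End AffineHypersurfaces.

(** * Self-similar motions *)

Lemma deriv_orthogonal_skew {R : realType} n (I : set R) (Q : R -> 'M[R]_n) A :
  ProperFilter (within I 0^') -> (forall t, I t -> Q t *m (Q t)^T = 1%:M) ->
  Q 0 = 1%:M -> is_deriv_in I Q 0 A -> skew_symmetric A.
Proof.
move=> PF orth Q0 dQ.
have dP := is_deriv_in_mulmx dQ (is_deriv_in_trmx dQ).
rewrite Q0 trmx1 mulmx1 mul1mx in dP.
have dP0 : is_deriv_in I (fun s => Q s *m (Q s)^T) 0 0.
  apply: cvg_near_cst; rewrite near_withinE; apply: nearW => s Is.
  by rewrite orth// Q0 trmx1 mulmx1 subrr scaler0.
have /eqP := is_deriv_in_unique PF dP dP0.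
by rewrite addrC addr_eq0 => /eqP.
Qed.

Lemma flow_initial_equation (R : realType) (n : nat) (M : manifold R n)
    (F : M -> 'cV[R]_n.+1) (I : set R) (g : R -> R) (Q : R -> 'M[R]_n.+1)
    (v : R -> 'cV[R]_n.+1) :
  self_similar_motion I g Q v ->
  mean_curvature_flow F I (fun t p => g t *: (Q t *m F p) + v t) ->
  exists (b : R) (A : 'M[R]_n.+1) (c : 'cV[R]_n.+1),
    [/\ is_deriv_in I (g : R -> R^o) 0 b, is_deriv_in I Q 0 A,
        is_deriv_in I v 0 c, skew_symmetric A &
        eq_neg_mean_curvature F (fun p nu =>
          b * dot (F p) nu + dot (A *m F p) nu + dot c nu)].
Proof.
move=> [[intI I0] Is orth [dg dQ dv] [g0 Q0 v0]] [F0 flow].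
have PF := within_interval_proper intI I0 Is.
have [b db] := dg 0 I0; have [A dA] := dQ 0 I0; have [c dc] := dv 0 I0.
exists b, A, c; split=> //.
  by apply: deriv_orthogonal_skew PF _ Q0 dA => t /orth[].
have [_ [V [dV]]] := flow 0 I0; rewrite F0 => eqV U N nN p Up.
rewrite -(eqV U N nN p Up).
have -> : V p = b *: F p + A *m F p + c.
  apply: is_deriv_in_unique PF (dV p) _; apply: is_deriv_inD dc.
  have := is_deriv_inZ db (is_deriv_in_mulmx dA (is_deriv_in_cst I (F p) 0)).
  by rewrite mulmx0 addr0 Q0 g0 mul1mx scale1r.
by rewrite !dotDl dotZl.
Qed.

(** These are the solutions of g' = b / g with g(0) = 1 and of
    theta' = 1 / g^2 with theta(0) = 0. *)
Lemma scaling_profile (R : realType) (b t : R) : b != 0 -> 0 < 2 * b * t + 1 ->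
  let g (s : R) := Num.sqrt (2 * b * s + 1) in
  [/\ 0 < g t, is_derive t 1 g (b / g t) &
      is_derive t 1 (fun s => ln (2 * b * s + 1) / (2 * b)) (g t ^- 2)].
Proof.
move=> b0 t0 g.
have dlin : is_derive t 1 (fun s : R => 2 * b * s + 1) (2 * b).
  by apply: is_derive_eq; rewrite addr0 [_ *: 1]mulr1.
have gt0 : 0 < g t by rewrite sqrtr_gt0.
split=> //.
  have := @is_derive1_comp R _ (fun s => 2 * b * s + 1) t _ _
    (is_derive1_sqrt t0) dlin.
  rewrite -/(g t); congr (is_derive t 1 _ _).
  by field; rewrite gt_eqF.
have dlog := @is_derive1_comp R _ (fun s => 2 * b * s + 1) t _ _
  (is_derive1_ln t0) dlin.
have -> : (fun s => ln (2 * b * s + 1) / (2 * b)) =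
    (2 * b)^-1 *: (@ln R \o (fun s => 2 * b * s + 1)).
  by apply/funext => s; rewrite !fctE mulrC.
apply: is_derive_eq.
rewrite sqr_sqrtr ?ltW// -[LHS]/(_ * _).
by field; rewrite b0 gt_eqF.
Qed.

Theorem mainTheorem1 (R : realType) (n : nat) (M : manifold R n)
    (F : M -> 'cV[R]_n.+1) (hF : immersion F)
    (hcomplete : complete_hypersurface F) :
  (forall (I : set R) (g : R -> R) (Q : R -> 'M[R]_n.+1) (v : R -> 'cV[R]_n.+1),
     self_similar_motion I g Q v ->
     mean_curvature_flow F I (fun t p => g t *: (Q t *m F p) + v t) ->
     exists (b : R) (A : 'M[R]_n.+1) (c : 'cV[R]_n.+1),
       [/\ is_deriv_in I (g : R -> R^o) 0 b, is_deriv_in I Q 0 A,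
           is_deriv_in I v 0 c, skew_symmetric A &
           eq_neg_mean_curvature F (fun p nu =>
             b * dot (F p) nu + dot (A *m F p) nu + dot c nu)])
  /\
  (forall (b : R) (A : 'M[R]_n.+1) (c : 'cV[R]_n.+1),
     skew_symmetric A ->
     eq_neg_mean_curvature F (fun p nu =>
       b * dot (F p) nu + dot (A *m F p) nu + dot c nu) ->
     (exists (I : set R) (g : R -> R) (Q : R -> 'M[R]_n.+1)
             (v : R -> 'cV[R]_n.+1),
        self_similar_motion I g Q v /\
        mean_curvature_flow F I (fun t p => g t *: (Q t *m F p) + v t))
     /\
     exists w : 'cV[R]_n.+1,
       let Fh : M -> 'cV[R]_n.+1 := fun p => F p + w in
       [/\ forall (U : set M) (N : M -> 'cV[R]_n.+1), unit_normal F U N ->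
             unit_normal Fh U N /\
             (forall p, U p -> mean_curvature Fh N p = mean_curvature F N p),
           b != 0 ->
             let I := [set t : R | 0 < 2 * b * t + 1] in
             let g := fun t : R => Num.sqrt (2 * b * t + 1) in
             let Q := fun t : R => mexp ((ln (2 * b * t + 1) / (2 * b)) *: A) in
             [/\ eq_neg_mean_curvature Fh (fun p nu =>
                   b * dot (Fh p) nu + dot (A *m Fh p) nu),
                 self_similar_motion I g Q (fun=> 0) &
                 mean_curvature_flow Fh I (fun t p => g t *: (Q t *m Fh p))] &
           b = 0 ->
             exists c0 : 'cV[R]_n.+1,
               [/\ A *m c0 = 0,
                   eq_neg_mean_curvature Fh (fun p nu =>
                     dot (A *m Fh p) nu + dot c0 nu),
                   self_similar_motion [set: R] (fun=> 1)
                     (fun t => mexp (t *: A)) (fun t => t *: c0) &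
                   mean_curvature_flow Fh [set: R] (fun t p =>
                     mexp (t *: A) *m Fh p + t *: c0)]]).

Proof.
split; first by move=> I g Q v; exact: flow_initial_equation.
move=> b A c skA eqF.
have [w [c0 [cE bc0 Ac0]]] := skew_decomposition b c skA.
have normal_translate := normal_and_curvature_translate w hF.
pose Fh p := F p + w.
have immFh : immersion Fh.
  have := immersion_affine w (unitmx1 _ _) hF.
  by congr immersion; apply/funext => p; rewrite mul1mx.
have eqFw : eq_neg_mean_curvature F (fun p nu =>
    b * dot (F p) nu + dot (A *m F p) nu + dot ((b%:M + A) *m w + c0) nu).
  by rewrite -cE.
have eqFh : eq_neg_mean_curvature Fh (fun p nu =>
    b * dot (Fh p) nu + dot (A *m Fh p) nu + dot ((b%:M + A) *m 0 + c0) nu).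
  move=> U N; have [nE HE] := normal_translate U N => /nE nN p Up.
  rewrite HE -(eqFw U N nN p Up) mulmx0 add0r /Fh mulmxDr mulmxDl mul_scalar_mx.
  rewrite !dotDl dotZl; ring.
(* The translation part of soliton_flow for w = 0. *)
have motion0 (k t : R) (P : 'M[R]_n.+1) :
    k *: (P *m 0) - 0 + t *: c0 = t *: c0 :> 'cV[R]_n.+1.
  by rewrite mulmx0 scaler0 subr0 add0r.
have translate U N : unit_normal F U N -> unit_normal Fh U N /\
    forall p, U p -> mean_curvature Fh N p = mean_curvature F N p.
  move=> nN; have [nE HE] := normal_translate U N.
  by split=> [|p _]; [exact/nE|exact: HE].
have [b0|b0] := eqVneq b 0.
  have profile (t : R) : [set: R] t -> [/\ 0 < 1 :> R,
      is_derive t 1 (fun=> 1 : R) (b / 1), is_derive t 1 id (1 ^- 2 : R) &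
      1^-1 *: c0 = c0].
    move=> _; rewrite b0 mul0r expr1n invr1 scale1r.
    by split; [exact: ltr01|exact: is_derive_cst|exact: is_derive_id|].
  have Tint : is_interval [set: R] by [].
  have T1 : exists s : R, [set: R] s /\ s != 0 by exists 1; rewrite oner_neq0.
  have soliton G u immG eqG := @soliton_flow R n M G b A u c0 setT (fun=> 1) id
    immG skA Ac0 eqG Tint I T1 erefl erefl profile.
  split.
    by do 4 eexists; exact: (soliton F w hF eqFw).
  exists w; split=> [|b_neq0|_]; [exact: translate|by case/eqP: b_neq0|].
  have [mot flow] := soliton Fh 0 immFh eqFh.
  exists c0; split=> //.
  - move=> U N nN p Up; rewrite -(eqFh U N nN p Up).
    by rewrite b0 mul0r add0r mulmx0 add0r.
  - by move: mot; congr self_similar_motion; apply/funext => t; exact: motion0.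
  - move: flow; congr mean_curvature_flow; apply/funext => t; apply/funext => p.
    by rewrite motion0 scale1r.
have c00 : c0 = 0.
  by apply/eqP; move/eqP: bc0; rewrite scaler_eq0 (negPf b0).
pose I := [set t : R | 0 < 2 * b * t + 1].
pose g (t : R) := Num.sqrt (2 * b * t + 1).
pose theta (t : R) := ln (2 * b * t + 1) / (2 * b).
have profile t : I t -> [/\ 0 < g t, is_derive t 1 g (b / g t),
    is_derive t 1 theta (g t ^- 2) & (g t)^-1 *: c0 = c0].
  move=> /(scaling_profile b0)[gt0 dg dtheta].
  by rewrite c00 scaler0.
have intI : is_interval I.
  move=> x y Ix Iy z /andP[xz zy]; rewrite /I /=.
  have [bpos|bneg] := ltP 0 b.
    apply: lt_le_trans Ix _; rewrite lerD2r ler_wpM2l// mulr_ge0// ltW//.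
  apply: lt_le_trans Iy _; rewrite lerD2r ler_wnM2l// mulr_ge0_le0//.
have I0 : I 0 by rewrite /I /= mulr0 add0r.
have I1 : exists s, I s /\ s != 0.
  by exists b^-1; rewrite invr_eq0 /I /= mulfK.
have g0 : g 0 = 1 by rewrite /g mulr0 add0r sqrtr1.
have theta0 : theta 0 = 0 by rewrite /theta mulr0 add0r ln1 mul0r.
have soliton G u immG eqG := @soliton_flow R n M G b A u c0 I g theta
  immG skA Ac0 eqG intI I0 I1 g0 theta0 profile.
split.
  by do 4 eexists; exact: (soliton F w hF eqFw).
exists w; split=> [|_|b_eq0]; [exact: translate| |by case/eqP: b0].
have [mot flow] := soliton Fh 0 immFh eqFh.
split.
- move=> U N nN p Up; rewrite -(eqFh U N nN p Up).
  by rewrite c00 mulmx0 addr0 [dot 0 _]dotE trmx0 mul0mx mxE addr0.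
- move: mot; congr self_similar_motion; apply/funext => t.
  by rewrite motion0 c00 scaler0.
- move: flow; congr mean_curvature_flow; apply/funext => t; apply/funext => p.
  by rewrite motion0 c00 scaler0 addr0.
Qed.
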